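(* Let $k\ge 1$ be an integer and let $g$ be the probability density on $(0,\infty)$ of the distance between two independent uniformly random points of a region of $k$-dimensional Euclidean space, with $$g(t)\sim \frac{k\,\pi^{k/2}}{\Gamma(k/2+1)}\,t^{k-1}\qquad (t\downarrow 0).$$ Let $\tilde G(s)=\int_0^\infty e^{-st}g(t)\,dt$ and $\mathbb{E}[d\mid s]=-\tilde G'(s)/\tilde G(s)$ (the mean edge length in the Waxman random graph on this region with parameter $s$). Then, as $s\to\infty$, $$\tilde G(s)\sim \frac{\pi^{k/2}\,\Gamma(k+1)}{\Gamma(k/2+1)}\,s^{-k},\qquad \tilde G'(s)\sim \frac{-k\,\pi^{k/2}\,\Gamma(k+1)}{\Gamma(k/2+1)}\,s^{-k-1},\qquad \mathbb{E}[d\mid s]\sim \frac{k}{s}.$$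
   Context: Waxman random graph: nodes are placed independently and uniformly at random in the region, and each pair of nodes at distance $d$ is independently made an edge with probability $q e^{-sd}$, where $q\in(0,1]$, $s\ge 0$. The small-$t$ behaviour of $g$ reflects that region-boundary effects are negligible at small distances (the region being normalised to have unit volume). Here $a(s)\sim b(s)$ means $a(s)/b(s)\to 1$. *)

(* Defs.v *)
From HB Require Import structures.
From mathcomp Require Import all_boot all_order all_algebra.
From mathcomp Require Import all_classical all_reals all_analysis.
From mathcomp Require Import measurable_realfun.
Set Implicit Arguments.
Unset Strict Implicit.
Unset Printing Implicit Defensive.
Import Order.TTheory GRing.Theory Num.Theory.
Import numFieldNormedType.Exports.

Local Open Scope classical_set_scope.
Local Open Scope ring_scope.

(* k-dimensional Euclidean space: [k.-tuple R] carries the product of the Borel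
   sigma-algebras, whereas ['rV[R]_k] has no measurable structure. *)
Notation euclidean R k := (k.-tuple (measurableTypeR R)).

Definition euclidean_dist (R : realType) (k : nat) (x y : euclidean R k) : R :=
  Num.sqrt (\sum_(i < k) (tnth x i - tnth y i) ^+ 2).

(* k-dimensional Lebesgue measure: the iterated product measure, each step being
   the integral over the first coordinate of the measures of the sections. *)
Fixpoint volume (R : realType) (k : nat) : set (euclidean R k) -> \bar R :=
  match k with
  | 0 => fun A => \d_([tuple] : euclidean R 0) A
  | j.+1 => fun A =>
      (\int[@lebesgue_measure R]_x volume [set t : euclidean R j | A (cons_tuple x t)])%E
  end.

(* Normalisation check for [volume]: it is the product of the lengths on boxes. *)
Lemma volume_box (R : realType) (k : nat) (A : 'I_k -> set (measurableTypeR R)) :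
  (forall i, measurable (A i)) ->
  volume [set t : euclidean R k | forall i, A i (tnth t i)] =
  (\prod_(i < k) @lebesgue_measure R (A i))%E.
Proof.
elim: k A => [|k IH] A mA /=.
  by rewrite big_ord0 diracE mem_set// => -[].
rewrite big_ord_recl -IH//.
set V := volume _.
have -> : lebesgue_measure (A ord0) = (\int[@lebesgue_measure R]_x (\1_(A ord0) x)%:E)%E.
  by rewrite integral_indic// setIT.
have V0 : (0 <= V)%E by rewrite /V (IH (fun i => A (lift ord0 i)))// prode_ge0.
rewrite -ge0_integralZr//; last first.
  by apply/measurable_EFinP; exact: measurable_indic.
apply: eq_integral => x _ /=.
have [xA|xA] := pselect (A ord0 x).
  rewrite indicE mem_set//= mul1e /V; congr volume.
  apply/seteqP; split => t /= H i.
    by have := H (lift ord0 i); rewrite tnthS.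
  by case: (unliftP ord0 i) => [j|] ->; rewrite ?tnthS.
rewrite indicE memNset//= mul0e.
rewrite (_ : mkset _ = set0); last first.
  by apply/seteqP; split => t //= /(_ ord0).
have [->|k0] := posnP k; first exact: measure0.
have := IH (fun=> set0) (fun=> measurable0).
rewrite (_ : mkset _ = set0); last first.
  by apply/seteqP; split => t //= /(_ (Ordinal k0)).
by move=> ->; rewrite (bigD1 (Ordinal k0))//= measure0 mul0e.
Qed.

Definition uniform_on (R : realType) (k : nat) (D : set (euclidean R k))
    d (T : measurableType d) (P : probability T R)
    (X : {RV P >-> euclidean R k}) : Prop :=
  forall A : set (euclidean R k), measurable A ->
    distribution P X A = (volume (A `&` D) / volume D)%E.

Definition independent_RV (R : realType) d (T : measurableType d)
    (P : probability T R) d' (U : measurableType d')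
    (X Y : {RV P >-> U}) : Prop :=
  forall A B : set U, measurable A -> measurable B ->
    P (X @^-1` A `&` Y @^-1` B) = (P (X @^-1` A) * P (Y @^-1` B))%E.

(* [g] is only constrained on (0, +oo). Taking [A := setT] gives total mass 1. *)
Definition is_density (R : realType) d (T : measurableType d)
    (P : probability T R) (Z : T -> R) (g : R -> R) : Prop :=
  [/\ measurable_fun (`]0, +oo[ : set R) g,
      (forall t, 0 < t -> 0 <= g t) &
      forall A : set (measurableTypeR R), measurable A ->
        P (Z @^-1` A) =
        (\int[@lebesgue_measure R]_(t in (A `&` `]0, +oo[)%R) (g t)%:E)%E].

Definition asymp_equiv (R : realType) (F : set_system R) (a b : R -> R) : Prop :=
  (fun x => a x / b x) @ F --> (1 : R).

Definition Gamma (R : realType) (x : R) : R :=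
  \int[@lebesgue_measure R]_(t in `]0, +oo[) (t `^ (x - 1) * expR (- t)).

Definition laplace (R : realType) (g : R -> R) (s : R) : R :=
  \int[@lebesgue_measure R]_(t in `]0, +oo[) (expR (- (s * t)) * g t).

Definition mean_edge_length (R : realType) (g : R -> R) (s : R) : R :=
  - derive1 (laplace g) s / laplace g s.

(* Main.v *)
Require Import Defs.
From mathcomp Require Import all_boot all_order all_algebra.
From mathcomp Require Import all_classical all_reals all_analysis.
From mathcomp Require Import measurable_realfun ring lra.
Import Order.TTheory GRing.Theory Num.Theory.
Import numFieldNormedType.Exports.
Local Open Scope classical_set_scope.
Local Open Scope ring_scope.

(** For large [s] the weight [expR (- (s * t))] concentrates at [t = 0], so the
    Laplace transform of [g] only sees the leading term of [g] at [0]. This is an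
    Abelian theorem of Watson's type ([laplace_asymp]): if [f t ~ c * t ^+ n] as
    [t] decreases to [0], with [c != 0], then the transform of [f] is equivalent
    to that of [c * t ^+ n], which is [c * n`! / s ^+ n.+1]. The comparison splits
    the integral at a small [delta]: below it the difference is a small multiple
    of [t ^+ n], and above it the integrand carries a factor
    [expR (- ((s - 1) * delta))], negligible against every power of [s]
    ([laplace_le_near0]).

    The density [g] is integrable, so its transform may be differentiated under
    the integral sign and has derivative minus the transform of [t * g t]
    ([is_derive_laplace]). As [t * g t ~ c * t ^+ k], the same theorem applies to
    the derivative. With [c = k * pi `^ (k / 2) / Gamma (k / 2 + 1)] the factorials
    combine into [k * k.-1`! = k`! = Gamma (k + 1)], and the equivalent of the mean
    edge length is the quotient of the two others. *)

(** * Differentiation of Laplace transforms *)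

Section LaplaceTransform.
Variable R : realType.
Implicit Types (f h : R -> R) (s t c : R).
Let mu := @lebesgue_measure R.

Let mO : measurable (`]0, +oo[%classic : set (measurableTypeR R)).
Proof. by []. Qed.

(** Integrability for every positive [s] is the condition stable under
    multiplication by [t], so that the derivative of a Laplace transform can be
    treated by the same results as the transform itself. *)
Definition laplace_integrable f : Prop :=
  forall s, 0 < s ->
    mu.-integrable `]0, +oo[ (fun t => (expR (- (s * t)) * f t)%:E).

Lemma measurable_exp_kernel (D : set R) (s : R) :
  measurable_fun D (fun t : R => expR (- (s * t))).
Proof.
apply: measurable_funTS; apply: measurableT_comp => //.
exact: measurableT_comp.
Qed.

Lemma ler_mul_exp (a t : R) : 0 < a -> t * expR (- (a * t)) <= a^-1.
Proof.
move=> a0; rewrite expRN ler_pdivrMr ?expR_gt0// ler_pdivlMl//.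
by apply: le_trans (expR_ge1Dx _); rewrite lerDr.
Qed.

(** Half of the exponential pays for the factor [t]:
    [t * expR (- (s * t / 2)) <= 2 / s]. *)
Lemma laplace_integrable_mulX f : laplace_integrable f ->
  laplace_integrable (fun t => t * f t).
Proof.
move=> fi s s0.
have s20 : 0 < s / 2 by rewrite divr_gt0.
have fi2 := fi _ s20.
have mf : measurable_fun (`]0, +oo[ : set R) (fun t => expR (- (s / 2 * t)) * f t).
  by have /integrableP[/measurable_EFinP] := fi2.
have E t : expR (- (s * t)) * (t * f t) =
    (t * expR (- (s / 2 * t))) * (expR (- (s / 2 * t)) * f t).
  have -> : - (s * t) = - (s / 2 * t) + - (s / 2 * t) by field.
  by rewrite expRD; ring.
apply: (le_integrable _ _ _ (integrableZl _ (s / 2)^-1 fi2)) => //.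
- apply/measurable_EFinP.
  apply: (eq_measurable_fun (fun t : R =>
    (t * expR (- (s / 2 * t))) * (expR (- (s / 2 * t)) * f t))).
    by move=> t _; rewrite E.
  apply: measurable_funM => //; apply: measurable_funM => //.
  exact: measurable_exp_kernel.
- move=> t /=; rewrite in_itv/= andbT => t0.
  change ((`|expR (- (s * t)) * (t * f t)|)%:E <=
    (`|(s / 2)^-1 * (expR (- (s / 2 * t)) * f t)|)%:E)%E.
  rewrite lee_fin E normrM [in leRHS]normrM.
  rewrite ler_wpM2r ?mulr_ge0//.
  have H := ler_mul_exp _ t s20.
  rewrite !ger0_norm//; first by rewrite invr_ge0 ltW.
  by rewrite mulr_ge0 ?expR_ge0// ltW.
Qed.

Lemma is_derive_exp_kernel (y t x : R) :
  is_derive x 1 (fun s : R => expR (- (s * t)) * y) (- (expR (- (x * t)) * (t * y))).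
Proof.
apply: is_derive_eq.
rewrite /GRing.scale/=; ring.
Qed.

(** Differentiation under the integral sign. On [`]s / 2, s + 1[] the derivative of
    the integrand in the parameter is bounded by its absolute value at [s / 2]. *)
Lemma is_derive_laplace f s : laplace_integrable f -> 0 < s ->
  is_derive s 1 (laplace f) (- laplace (fun t => t * f t) s).
Proof.
move=> fi s0.
have tfi := laplace_integrable_mulX _ fi.
have s20 : 0 < s / 2 by rewrite divr_gt0.
pose F (x t : R) := expR (- (x * t)) * f t.
pose G t := `|expR (- (s / 2 * t)) * (t * f t)|.
have dF (x t : R) : partial1of2 F x t = - (expR (- (x * t)) * (t * f t)).
  by rewrite partial1of2E; exact: (@derive_val _ _ _ _ _ _ _ (is_derive_exp_kernel _ _ _)).
have sI : `]s / 2, s + 1[%classic s.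
  by rewrite /= in_itv/= ltrDl ltr01 andbT; lra.
have Fi x : `]s / 2, s + 1[%classic x -> mu.-integrable `]0, +oo[ (EFin \o F x).
  rewrite /= in_itv/= => /andP[sx _]; exact: fi (lt_trans s20 sx).
have Fd x t : `]s / 2, s + 1[%classic x -> `]0, +oo[%classic t -> derivable (F ^~ t) x 1.
  by move=> _ _; exact: (@ex_derive _ _ _ _ _ _ _ (is_derive_exp_kernel _ _ _)).
have Gi : mu.-integrable `]0, +oo[ (EFin \o G).
  exact: (integrable_abse (tfi _ s20)).
have FG x t : `]s / 2, s + 1[%classic x -> `]0, +oo[%classic t ->
    `|partial1of2 F x t| <= G t.
  rewrite /= !in_itv/= andbT => /andP[sx _] t0.
  rewrite dF normrN /G !normrM ler_wpM2r ?mulr_ge0//.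
  rewrite !ger0_norm ?expR_ge0// ler_expR lerN2 ler_pM2r// ltW//.
have D1 := @derivable_under_integral R _ _ mu F _ mO s _ _ sI Fi Fd G
  (fun=> normr_ge0 _) Gi FG.
have D2 := @differentiation_under_integral R _ _ mu F _ mO s _ _ sI Fi Fd G
  (fun=> normr_ge0 _) Gi FG.
apply: DeriveDef => //.
rewrite -derive1E [LHS]D2.
under eq_Rintegral do rewrite dF -mulN1r.
by rewrite RintegralZl ?mulN1r//; exact: tfi.
Qed.

(** * Transforms of monomials *)

Lemma laplace_one : laplace_integrable (fun _ : R => 1) /\
  forall s, 0 < s -> laplace (fun _ : R => 1) s = s^-1.
Proof.
suff H s : 0 < s ->
    (\int[mu]_(t in (`]0%R, +oo[ : set R)) (expR (- (s * t)) * 1)%:E = (s^-1)%:E)%E.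
  split=> s s0; last by rewrite /laplace /Rintegral H.
  apply/integrableP; split.
    by apply/measurable_EFinP; apply: measurable_funM => //; exact: measurable_exp_kernel.
  suff -> : (\int[mu]_(t in (`]0%R, +oo[ : set R)) `|(expR (- (s * t)) * 1)%:E| =
      (s^-1)%:E)%E by exact: ltry.
  rewrite -H//; apply: eq_integral => t _.
  by rewrite abse_EFin ger0_norm// mulr1 expR_ge0.
move=> s0.
pose F t : R := - s^-1 * expR (- (s * t)).
have dF (x : R) : is_derive x 1 F (expR (- (s * x)) * 1).
  apply: is_derive_eq; rewrite /GRing.scale/=; field; exact: lt0r_neq0.
have cF : continuous F.
  by move=> x; apply/differentiable_continuous/derivable1_diffP;
    exact: (@ex_derive _ _ _ _ _ _ _ (dF x)).
have mk (D : set R) : measurable_fun D (fun t : R => (expR (- (s * t)) * 1)%:E).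
  by apply/measurable_EFinP; apply: measurable_funM => //; exact: measurable_exp_kernel.
rewrite integral_itv_obnd_cbnd//.
rewrite (@ge0_continuous_FTC2y _ _ F 0 0).
- by rewrite /F mulr0 oppr0 expR0 mulr1 -EFinB sub0r opprK.
- by move=> x _; rewrite mulr1 expR_ge0.
- apply: continuous_subspaceT => x.
  apply/differentiable_continuous/derivable1_diffP.
  exact: ex_derive.
- rewrite /F -[X in _ --> X](mulr0 (- s^-1)); apply: cvgM; first exact: cvg_cst.
  apply: (cvg_comp (fun x : R => s * x) (fun x : R => expR (- x))).
    by apply: gt0_cvgMry => //; exact: cvg_id.
  exact: cvgr_expR.
- by move=> x _; exact: (@ex_derive _ _ _ _ _ _ _ (dF x)).
- by apply: cvg_at_right_filter; exact: cF.
- by move=> x _; rewrite derive1E; exact: (@derive_val _ _ _ _ _ _ _ (dF x)).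
Qed.

(** Since [t ^+ n.+1 = t * t ^+ n], the induction step is a differentiation of
    [n`! / s ^+ n.+1] with respect to [s]. *)
Lemma laplace_monomial n : laplace_integrable (fun t : R => t ^+ n) /\
  forall s, 0 < s -> laplace (fun t : R => t ^+ n) s = n`!%:R / s ^+ n.+1.
Proof.
elim: n => [|n [IHi IH]].
  have -> : (fun t : R => t ^+ 0) = fun=> 1 by apply/funext => t; rewrite expr0.
  have [i0 L0] := laplace_one; split=> // s s0.
  by rewrite L0// fact0 expr1 mul1r.
have -> : (fun t : R => t ^+ n.+1) = fun t => t * t ^+ n.
  by apply/funext => t; rewrite exprS.
split=> [|s s0]; first exact: laplace_integrable_mulX.
have dL := is_derive_laplace _ _ IHi s0.
have dQ : is_derive s 1 (fun x : R => n`!%:R * (x ^+ n.+1)^-1)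
    (- (n.+1`!%:R / s ^+ n.+2)).
  have sn0 : s ^+ n.+1 != 0 by rewrite expf_neq0 ?gt_eqF.
  have dP : is_derive s 1 (fun x : R => x ^+ n.+1) (n.+1%:R * s ^+ n).
    apply: DeriveDef; first exact: exprn_derivable.
    by rewrite exp_derive scaler1.
  have dV := @is_deriveV _ (fun x : R => x ^+ n.+1) _ _ _ sn0 dP.
  apply: is_derive_eq.
  rewrite factS natrM /GRing.scale/= !exprS.
  field.
  by rewrite expf_neq0 ?gt_eqF.
apply: oppr_inj.
rewrite -(@derive_val _ _ _ _ _ _ _ dL) -(@derive_val _ _ _ _ _ _ _ dQ).
apply: near_eq_derive.
near=> x; apply: IH.
by near: x; exact: lt_nbhsr.
Unshelve. all: by end_near. Qed.

(** * Transforms for a large parameter *)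

Lemma laplace_integrableZ c f : laplace_integrable f ->
  laplace_integrable (fun t => c * f t).
Proof.
move=> fi s s0.
have E t : c * (expR (- (s * t)) * f t) = expR (- (s * t)) * (c * f t) by ring.
apply: (eq_integrable mO _ _ _ (integrableZl mO c (fi s s0))).
by move=> t _; exact: (congr1 EFin (E t)).
Qed.

Lemma laplace_integrableB f h : laplace_integrable f -> laplace_integrable h ->
  laplace_integrable (fun t => f t - h t).
Proof.
move=> fi hi s s0.
have E t : expR (- (s * t)) * f t - expR (- (s * t)) * h t =
    expR (- (s * t)) * (f t - h t) by ring.
apply: (eq_integrable mO _ _ _ (integrableB mO (fi s s0) (hi s s0))).
by move=> t _; exact: (congr1 EFin (E t)).
Qed.

Lemma laplace_integrable_norm f : laplace_integrable f ->
  laplace_integrable (fun t => `|f t|).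
Proof.
move=> fi s s0.
have E t : `|expR (- (s * t)) * f t| = expR (- (s * t)) * `|f t|.
  by rewrite normrM ger0_norm// expR_ge0.
apply: (eq_integrable mO _ _ _ (integrable_abse (fi s s0))).
by move=> t _; exact: (congr1 EFin (E t)).
Qed.

(** The bound on [h] near [0] controls the integral over [t < delta]; for
    [delta <= t] and [1 <= s] one has
    [expR (- (s * t)) <= expR (- ((s - 1) * delta)) * expR (- t)],
    so the rest of the integral is exponentially small in [s]. *)
Lemma laplace_le_near0 h (n : nat) (A delta s : R) : laplace_integrable h ->
  0 <= A -> 0 < delta -> 1 <= s ->
  (forall t, 0 < t < delta -> `|h t| <= A * t ^+ n) ->
  `|laplace h s| <= A * (n`!%:R / s ^+ n.+1)
     + expR (- ((s - 1) * delta)) * laplace (fun t => `|h t|) 1.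
Proof.
move=> hi A0 d0 s1 hA.
have s0 : 0 < s by exact: lt_le_trans s1.
have [mi mL] := laplace_monomial n.
have ni := laplace_integrable_norm _ hi.
pose B : R := expR (- ((s - 1) * delta)).
have i1 : mu.-integrable `]0, +oo[ (fun t => (A * (expR (- (s * t)) * t ^+ n))%:E).
  exact: (integrableZl mO A (mi _ s0)).
have i2 : mu.-integrable `]0, +oo[ (fun t => (B * (expR (- (1 * t)) * `|h t|))%:E).
  exact: (integrableZl mO B (ni _ ltr01)).
apply: (le_trans (le_normr_Rintegral mO (hi s s0))).
rewrite -mL// /laplace -/B -!RintegralZl//; [|exact: ni|exact: mi].
rewrite -RintegralD//.
apply: le_Rintegral => //.
- exact: (integrable_abse (hi s s0)).
- have := integrableD mO i1 i2.
  by apply: eq_integrable.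
move=> t /=; rewrite in_itv/= andbT => t0.
rewrite normrM (ger0_norm (expR_ge0 _)).
have [td|dt] := ltP t delta.
  apply: (@le_trans _ _ (A * (expR (- (s * t)) * t ^+ n))).
    rewrite mulrCA ler_wpM2l ?expR_ge0//.
    by apply: hA; rewrite t0.
  by rewrite lerDl !mulr_ge0 ?expR_ge0.
apply: (@le_trans _ _ (B * (expR (- (1 * t)) * `|h t|))).
  rewrite mulrA ler_wpM2r// /B -expRD ler_expR.
  (* (s - 1) * (t - delta) >= 0 *)
  nra.
by rewrite lerDr !mulr_ge0 ?expR_ge0// exprn_ge0// ltW.
Qed.

(** One power more suffices: [(s * a) ^+ n.+1 / n.+1`! <= expR (s * a)] bounds
    the function by a multiple of [s^-1]. *)
Lemma cvg_expr_exp n (a : R) : 0 < a ->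
  (fun s : R => s ^+ n * expR (- (s * a))) @ +oo --> (0 : R).
Proof.
move=> a0.
pose M : R := n.+1`!%:R / a ^+ n.+1.
apply: (@squeeze_cvgr _ _ _ _ (fun=> 0) (fun s : R => M * s^-1)).
- near=> s.
  have s0 : 0 < s by near: s; exact: nbhs_pinfty_gt.
  rewrite mulr_ge0 ?expR_ge0 ?exprn_ge0 ?(ltW s0)//=.
  have sa0 : 0 <= s * a by rewrite mulr_ge0// ltW.
  rewrite expRN ler_pdivrMr ?expR_gt0//.
  have := expR_ge1Dxn n sa0 => E.
  have {}E : (s * a) ^+ n.+1 / n.+1`!%:R <= expR (s * a).
    by apply: le_trans E; rewrite lerDr.
  apply: le_trans (ler_wpM2l _ E); last first.
    by rewrite mulr_ge0 ?invr_ge0 ?(ltW s0)// divr_ge0// exprn_ge0// ltW.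
  rewrite /M exprMn [s ^+ n.+1]exprS.
  rewrite le_eqVlt; apply/orP; left; apply/eqP; field.
  by rewrite expf_neq0 ?gt_eqF//= ltr0n fact_gt0.
- exact: cvg_cst.
- rewrite -[X in _ --> X](mulr0 M); apply: cvgM; first exact: cvg_cst.
  apply/(@gtr0_cvgV0 _ _ _ _ (fun s : R => s)); last exact: cvg_id.
  exact: nbhs_pinfty_gt.
Unshelve. all: by end_near. Qed.

(** Watson's lemma, to leading order: apply [laplace_le_near0] to
    [f t - c * t ^+ n], which is at most [e / 2 * `|c| * t ^+ n] near [0], and
    divide by the transform of [c * t ^+ n]. *)
Lemma laplace_asymp f (n : nat) c : laplace_integrable f -> c != 0 ->
  asymp_equiv 0^'+ f (fun t => c * t ^+ n) ->
  asymp_equiv +oo (laplace f) (fun s => c * n`!%:R / s ^+ n.+1).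
Proof.
move=> fi c0 f0.
have [mi mL] := laplace_monomial n.
have cmi := laplace_integrableZ c _ mi.
pose h t := f t - c * t ^+ n.
have hi : laplace_integrable h by exact: laplace_integrableB.
have nf0 : (0 : R) < n`!%:R by rewrite ltr0n fact_gt0.
have Lh s : 0 < s -> laplace h s = laplace f s - c * n`!%:R / s ^+ n.+1.
  move=> s0; rewrite -mulrA -mL// /laplace -RintegralZl//; last exact: mi.
  rewrite -RintegralB//; [|exact: fi|].
    by apply: eq_Rintegral => t _; rewrite /h; ring.
  exact: (integrableZl mO c (mi _ s0)).
apply/cvgrPdist_le => e e0.
have e20 : 0 < e / 2 by rewrite divr_gt0.
have [delta /= d0 hd] : exists2 delta : R, 0 < delta &
    forall t, 0 < t < delta -> `|h t| <= (e / 2 * `|c|) * t ^+ n.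
  move/cvgrPdist_le : f0 => /(_ _ e20)[d /= d0 H].
  exists d => // t /andP[t0 td].
  have ct : c * t ^+ n != 0 by rewrite mulf_neq0// expf_neq0// gt_eqF.
  have := H t; rewrite /= sub0r normrN gtr0_norm// => /(_ td t0).
  have -> : h t = - ((1 - f t / (c * t ^+ n)) * (c * t ^+ n)).
    by rewrite mulrBl mul1r divfK// opprB.
  move=> E; rewrite normrN normrM [X in _ * X]normrM.
  rewrite [X in _ * (_ * X)]ger0_norm ?exprn_ge0 ?(ltW t0)//.
  by rewrite -[leRHS]mulrA ler_wpM2r// mulr_ge0// exprn_ge0// ltW.
pose K : R := laplace (fun t => `|h t|) 1.
pose M : R := expR delta * K / (`|c| * n`!%:R).
have A0 : 0 <= e / 2 * `|c| by rewrite mulr_ge0// ltW.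
have : (fun s : R => M * (s ^+ n.+1 * expR (- (s * delta)))) @ +oo --> (0 : R).
  rewrite -[X in _ --> X](mulr0 M); apply: cvgM; first exact: cvg_cst.
  exact: cvg_expr_exp.
move=> /cvgrPdist_le /(_ _ e20) HM.
near=> s.
have s1 : 1 <= s by near: s; exact: nbhs_pinfty_ge.
have s0 : 0 < s by exact: lt_le_trans s1.
have HMs : M * (s ^+ n.+1 * expR (- (s * delta))) <= e / 2.
  apply: le_trans (ler_norm _) _.
  by rewrite -normrN -sub0r; near: s.
have sn0 : 0 < s ^+ n.+1 by rewrite exprn_gt0.
have cp : 0 < `|c| by rewrite normr_gt0.
have := laplace_le_near0 h n _ _ _ hi A0 d0 s1 hd; rewrite -/K => B.
have -> : 1 - laplace f s / (c * n`!%:R / s ^+ n.+1) =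
    - (laplace h s / (c * n`!%:R / s ^+ n.+1)).
  rewrite Lh//; field.
  by rewrite c0 !gt_eqF.
rewrite normrN normrM normfV.
have -> : `|c * n`!%:R / s ^+ n.+1| = `|c| * n`!%:R / s ^+ n.+1.
  by rewrite !normrM normfV !(gtr0_norm sn0) (gtr0_norm nf0).
rewrite ler_pdivrMr; last by rewrite divr_gt0// mulr_gt0.
apply: (le_trans B).
rewrite [in leRHS](splitr e) [in leRHS]mulrDl.
apply: lerD; first by rewrite !mulrA.
apply: le_trans (ler_wpM2r _ HMs); last first.
  by rewrite ltW// divr_gt0// mulr_gt0.
rewrite le_eqVlt; apply/orP; left; apply/eqP.
have -> : - ((s - 1) * delta) = delta + - (s * delta) by ring.
rewrite expRD /M; field.
by rewrite !gt_eqF.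
Unshelve. all: by end_near. Qed.

(** * Application to the distance density *)

(** A density has total mass one, and [expR (- (s * t)) <= 1] for positive [s] and [t]. *)
Lemma is_density_laplace_integrable d (T : measurableType d)
    (P : probability T R) (Z : T -> R) (g : R -> R) :
  is_density P Z g -> laplace_integrable g.
Proof.
move=> [mg g0 Pg] s s0.
have gi : mu.-integrable `]0, +oo[ (EFin \o g).
  apply/integrableP; split; first exact/measurable_EFinP.
  have := Pg setT measurableT.
  rewrite setTI preimage_setT probability_setT => E.
  apply: (@le_lt_trans _ _ 1%E); last by rewrite ltry.
  rewrite E le_eqVlt; apply/orP; left; apply/eqP; apply: eq_integral => t.
  by rewrite inE/= in_itv/= andbT => t0; rewrite ger0_norm// g0.
apply: (le_integrable mO _ _ gi).
  by apply/measurable_EFinP/measurable_funM => //; exact: measurable_exp_kernel.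
move=> t /=; rewrite in_itv/= andbT => t0.
rewrite lee_fin normrM ler_piMl// ger0_norm ?expR_ge0//.
by rewrite -expR0 ler_expR oppr_le0 mulr_ge0// ltW.
Qed.

Lemma Gamma_fact n : Gamma (n%:R + 1 : R) = n`!%:R.
Proof.
have [_ /(_ 1 ltr01)] := laplace_monomial n.
rewrite expr1n divr1 => <-.
apply: eq_Rintegral => t; rewrite inE/= in_itv/= andbT => t0.
by rewrite addrK powR_mulrn ?(ltW t0)// mul1r mulrC.
Qed.

End LaplaceTransform.

Theorem mainTheorem2 (R : realType) (k : nat) (hk : (1 <= k)%N)
    (D : set (euclidean R k)) (mD : measurable D) (volD : volume D = 1%E)
    (d : measure_display) (T : measurableType d) (P : probability T R)
    (X Y : {RV P >-> euclidean R k})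
    (hX : uniform_on D X) (hY : uniform_on D Y) (hXY : independent_RV X Y)
    (g : R -> R)
    (hg : is_density P (fun w => euclidean_dist (X w) (Y w)) g)
    (hg0 : asymp_equiv 0^'+ g
      (fun t => k%:R * pi `^ (k%:R / 2) / Gamma (k%:R / 2 + 1) * t ^+ k.-1)) :
  (forall s : R, 0 < s -> derivable (laplace g) s 1) /\
  asymp_equiv +oo (laplace g)
    (fun s => pi `^ (k%:R / 2) * Gamma (k%:R + 1) / Gamma (k%:R / 2 + 1) * s ^- k) /\
  asymp_equiv +oo (derive1 (laplace g))
    (fun s => - k%:R * pi `^ (k%:R / 2) * Gamma (k%:R + 1) / Gamma (k%:R / 2 + 1)
              * s ^- k.+1) /\
  asymp_equiv +oo (mean_edge_length g) (fun s => k%:R / s).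
Proof.
have gi := is_density_laplace_integrable R _ _ _ _ _ hg.
have tgi := laplace_integrable_mulX R _ gi.
have k0 : (0 : R) < k%:R by rewrite ltr0n.
have dL (s : R) : 0 < s -> is_derive s 1 (laplace g) (- laplace (fun t => t * g t) s).
  exact: is_derive_laplace.
have dLE (s : R) : 0 < s -> derive1 (laplace g) s = - laplace (fun t => t * g t) s.
  by move=> /dL/(@derive_val _ _ _ _ _ _ _); rewrite -derive1E.
set v : R := pi `^ (k%:R / 2) in hg0 *.
set W : R := Gamma (k%:R / 2 + 1) in hg0 *.
pose c : R := k%:R * v / W.
(* Both [pi `^ _] and [Gamma _] may be inverted because, division by zero being
   zero, [c = 0] would make the quotient in [hg0] vanish identically, while it
   tends to one. *)
have c0 : c != 0.
  apply/eqP => c0.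
  have H : (fun=> 0 : R) @ (0 : R)^'+ --> (1 : R).
    apply: cvg_trans hg0; apply: near_eq_cvg; near=> t.
    by rewrite -/c c0 mul0r invr0 mulr0.
  have E : (0 : R) = 1 by exact: (cvg_unique (@norm_hausdorff _ R) (cvg_cst (0 : R)) H).
  by move/eqP : E; rewrite eq_sym oner_eq0.
have ck : k%:R * k.-1`!%:R = k`!%:R :> R.
  by rewrite -natrM -[in LHS](prednK hk) -factS prednK.
have tg0 : asymp_equiv 0^'+ (fun t => t * g t) (fun t => c * t ^+ k).
  apply: cvg_trans hg0; apply: near_eq_cvg; near=> t.
  have t0 : t != 0 by rewrite gt_eqF//; near: t; exact: nbhs_right_gt.
  rewrite -/c -[in RHS](prednK hk) exprS; field.
  by rewrite t0 c0 expf_neq0.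
have L0 : asymp_equiv +oo (laplace g)
    (fun s => v * Gamma (k%:R + 1) / W * s ^- k).
  have := laplace_asymp R _ _ _ gi c0 hg0.
  rewrite Gamma_fact -ck (prednK hk).
  congr (asymp_equiv _ _ _); apply/funext => s.
  by rewrite /c; ring.
have L1 : asymp_equiv +oo (derive1 (laplace g))
    (fun s => - k%:R * v * Gamma (k%:R + 1) / W * s ^- k.+1).
  apply: cvg_trans (laplace_asymp R _ _ _ tgi c0 tg0).
  apply: near_eq_cvg; near=> s.
  have s0 : 0 < s by near: s; exact: nbhs_pinfty_gt.
  rewrite dLE// Gamma_fact !mulNr invrN mulrN opprK; congr (_ / _).
  by rewrite /c; ring.
split; first by move=> s s0; exact: (@ex_derive _ _ _ _ _ _ _ (dL s s0)).
split=> //; split=> //.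
have W0 : W != 0 by apply: contraNneq c0 => W0; rewrite /c W0 invr0 mulr0.
have v0 : v != 0 by apply: contraNneq c0 => v0; rewrite /c v0 mulr0 mul0r.
have L2 : (fun s : R => (derive1 (laplace g) s /
      (- k%:R * v * Gamma (k%:R + 1) / W * s ^- k.+1)) *
    (laplace g s / (v * Gamma (k%:R + 1) / W * s ^- k))^-1) @ +oo --> (1 : R).
  rewrite -[X in _ --> X](_ : 1 * 1^-1 = 1); last by rewrite invr1 mulr1.
  apply: cvgM; first exact: L1.
  by apply: cvgV; [exact: oner_neq0|exact: L0].
apply: cvg_trans L2; apply: near_eq_cvg; near=> s.
have s0 : 0 < s by near: s; exact: nbhs_pinfty_gt.
rewrite /mean_edge_length /= Gamma_fact.
have kf : k`!%:R != 0 :> R by rewrite pnatr_eq0 -lt0n fact_gt0.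
(* If the transform vanishes, both quotients are zero by convention. *)
have [->|L] := eqVneq (laplace g s) 0; first by rewrite invr0 !(mul0r, mulr0, invr0).
rewrite exprS; field.
by rewrite L W0 v0 kf expf_neq0 ?gt_eqF.
Unshelve. all: by end_near. Qed.
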